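(* Let $f\in\mathbb{R}[t_1,\dots,t_n]$ be a homogeneous polynomial of degree $d\ge3$ and let $\mathscr{K}$ be an open, convex and effective cone in $\mathbb{R}^n$. Suppose that (1) $D_{\mathbf{v}_1}\cdots D_{\mathbf{v}_d}f>0$ for all $\mathbf{v}_1,\dots,\mathbf{v}_d\in\mathscr{K}$; (2) for all $\mathbf{v}_1,\dots,\mathbf{v}_{d-2}\in\mathscr{K}$, the Hessian of $D_{\mathbf{v}_1}\cdots D_{\mathbf{v}_{d-2}}f$ is irreducible and its off-diagonal entries are nonnegative; (3) $\partial_if$ is $\mathscr{K}$-Lorentzian for all $i$. Then $f$ is $\mathscr{K}$-Lorentzian.
   Context: $D_\mathbf{u}=\sum_iu_i\partial_i$. The lineality space of an open convex cone $\mathscr{K}$ is $L_\mathscr{K}=\overline{\mathscr{K}}\cap-\overline{\mathscr{K}}$; $\mathscr{K}$ is effective if $\mathscr{K}=\mathscr{K}\cap\mathbb{R}^n_{>0}+L_\mathscr{K}$. A symmetric matrix $(a_{ij})$ with nonnegative off-diagonal entries is irreducible if for all distinct $i,j$ there is a sequence $i=i_0,i_1,\dots,i_\ell=j$ with consecutive indices distinct and $a_{i_0i_1}\cdots a_{i_{\ell-1}i_\ell}>0$. A homogeneous polynomial $g$ of degree $m\ge1$ is $\mathscr{K}$-Lorentzian if for all $\mathbf{v}_1,\dots,\mathbf{v}_m\in\mathscr{K}$: $D_{\mathbf{v}_1}\cdots D_{\mathbf{v}_m}g>0$, and (when $m\ge2$) the bilinear form $(\mathbf{x},\mathbf{y})\mapsto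 D_\mathbf{x}D_\mathbf{y}D_{\mathbf{v}_3}\cdots D_{\mathbf{v}_m}g$ has exactly one positive eigenvalue; nonnegative constants are $\mathscr{K}$-Lorentzian. *)

(* Defs.v *)
From HB Require Import structures.
From mathcomp Require Import all_boot all_order all_algebra.
From mathcomp Require Import boolp classical_sets reals topology convex.
From mathcomp Require Import mpoly.

Set Implicit Arguments.
Unset Strict Implicit.
Unset Printing Implicit Defensive.

Import Order.TTheory GRing.Theory Num.Theory.
Import numFieldTopology.Exports.

Local Open Scope classical_set_scope.
Local Open Scope ring_scope.

Section Derivatives.
Context {R : realType} {n : nat}.
Implicit Types (g : {mpoly R[n]}) (v x y : 'rV[R]_n) (vs : seq 'rV[R]_n).

Definition dirD v g : {mpoly R[n]} := \sum_(i < n) v 0 i *: g^`M(i).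

Definition dirDs vs g : {mpoly R[n]} := foldr dirD g vs.

(* In all uses below, the derivative whose constant coefficient is taken is   *)
(* itself a constant polynomial: m derivatives of a form of degree m.         *)
Definition dirval vs g : R := (dirDs vs g)@_0%MM.

(* Only used for quadratic forms, whose second partials are constants. *)
Definition hessian g : 'M[R]_n := \matrix_(i, j) (g^`M(i)^`M(j))@_0%MM.

Definition gram (B : 'rV[R]_n -> 'rV[R]_n -> R) : 'M[R]_n :=
  \matrix_(i, j) B (delta_mx 0 i) (delta_mx 0 j).

End Derivatives.

Section Matrices.
Context {R : realType} {n : nat}.
Implicit Type A : 'M[R]_n.

Definition offdiag_nonneg A := forall i j, i != j -> 0 <= A i j.

(* The sequence i = i_0, i_1, ..., i_l = j is i :: s; pairmap lists the       *)
(* entries A i_0 i_1, ..., A i_(l-1) i_l.                                     *)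
Definition irreducible_mx A := forall i j : 'I_n, i != j ->
  exists s : seq 'I_n,
    [/\ path (fun a b => a != b) i s, last i s = j
      & 0 < \prod_(c <- pairmap (fun a b => A a b) i s) c].

(* Eigenvalues are counted with algebraic multiplicity. *)
Definition one_pos_eigenvalue A := exists a : R,
  [/\ 0 < a, mup a (char_poly A) = 1%N
    & forall b, 0 < b -> eigenvalue A b -> b = a].

End Matrices.

Section Cones.
Context {R : realType} {n : nat}.
Implicit Type K : set 'rV[R]_n.

Definition is_cone K := forall (c : R) x, 0 < c -> K x -> K (c *: x).

Definition lineality K : set 'rV[R]_n :=
  closure K `&` [set - x | x in closure K].

Definition pos_orthant : set 'rV[R]_n := [set x | forall i, 0 < x 0 i].

Definition effective K :=
  K = [set x + y | x in K `&` pos_orthant & y in lineality K].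

Definition lorentzian_deg K (m : nat) (g : {mpoly R[n]}) :=
  [/\ g \is m.-homog,
      forall vs : m.-tuple 'rV[R]_n,
        (forall i, K (tnth vs i)) -> 0 < dirval vs g
    & (2 <= m)%N -> forall vs : (m - 2).-tuple 'rV[R]_n,
        (forall i, K (tnth vs i)) ->
        one_pos_eigenvalue (gram (fun x y => dirval [:: x, y & vs] g))].

(* The zero polynomial counts as a nonnegative constant. *)
Definition lorentzian K (g : {mpoly R[n]}) :=
  (exists2 c : R, 0 <= c & g = c%:MP) \/
  (exists2 m : nat, (1 <= m)%N & lorentzian_deg K m g).

End Cones.

(* Main.v *)
(** Fix [w, v_4, ..., v_d] in [K]. An element [y] of the lineality space satisfies
[D_(v + t y) ... f > 0] for every real [t], so [D_y] kills every derivative of [f]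
along [K]; as [K] is effective, one may thus take [w] with positive coordinates.
Let [A] be the Hessian of [D_w D_(v_4) ... D_(v_d) f] and [A_i] that of
[D_(v_4) ... D_(v_d) d_i f].  By symmetry of third derivatives
[A = sum_i w_i A_i] and [(x A)_i = x A_i w]. Each [A_i] has Lorentzian signature, so
the reverse Cauchy-Schwarz inequality [(x A_i w)^2 >= (x A_i x) (w A_i w)] sums to
[x A x <= sum_i w_i (x A)_i^2 / (w A)_i].  In terms of [B = D^-1 A], with [D] the
diagonal matrix of the [(w A)_i / w_i], this says that [<x, B x> <= <B x, B x>] for
the inner product given by [D]: each eigenvalue of [B] is at most [0] or at least [1].
But [B w = w] with [w > 0], so by Perron-Frobenius [1] is the largest eigenvalue and
it is simple. Hence [B], and with it [A], has exactly one positive eigenvalue. *)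
Require Import Defs.
From HB Require Import structures.
From mathcomp Require Import all_boot all_order all_algebra.
From mathcomp Require Import boolp classical_sets reals topology convex.
From mathcomp Require Import mpoly.
From mathcomp Require Import interval_inference complex ring lra zify.

Set Implicit Arguments.
Unset Strict Implicit.
Unset Printing Implicit Defensive.

Import Order.TTheory GRing.Theory Num.Theory.
Import numFieldTopology.Exports.

Local Open Scope classical_set_scope.
Local Open Scope ring_scope.

(** * Orthogonal diagonalization of real symmetric matrices *)

Section SpectralTheorem.
Variable R : rcfType.

(** The complexification of [A] is Hermitian, hence unitarily diagonalizable with real spectrum; a
    real root of the characteristic polynomial descends to [R]. *)
Lemma symmetric_eigenvalue n (A : 'M[R]_n.+1) :
  A^T = A -> exists a, eigenvalue A a.
Proof.
move=> As; pose B := map_mx (real_complex R) A.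
have Bh : B \is hermsymmx.
  apply/is_hermitianmxP; rewrite expr0 scale1r; apply/matrixP => i j.
  by rewrite !mxE -[in LHS]As mxE; symmetry; exact: conjc_real.
have /hermitian_normalmx/orthomx_spectralP Beq := Bh.
set P := spectralmx B in Beq; set d := spectral_diag B in Beq.
have Pu : P \in unitmx by exact: spectral_unit.
have /mxOverP/(_ 0 0) := hermitian_spectral_diag_real Bh.
rewrite -/d => dr; have {dr} [r dE] : exists r : R, d 0 0 = real_complex R r.
  case: (d 0 0) dr => x y; rewrite realE !lecE /= => h.
  exists x; congr (Complex _ _); apply/eqP.
  by case/orP: h => /andP[]; rewrite // eq_sym.
exists r; rewrite eigenvalue_root_char -(fmorph_root (real_complex R)).
rewrite map_char_poly -eigenvalue_root_char -/B /= -dE.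
apply/eigenvalueP; exists (row 0 P).
  rewrite -row_mul Beq !mulmxA mulmxV // mul1mx row_mul row_diag_mx.
  by rewrite -scalemxAl -rowE.
apply/eqP => /(congr1 (mulmx^~ (invmx P))).
rewrite -row_mul mulmxV // mul0mx => /rowP/(_ 0).
by rewrite !mxE /= => /eqP; rewrite oner_eq0.
Qed.

Lemma norm_row_ge0 n (x : 'rV[R]_n) : 0 <= (x *m x^T) 0 0.
Proof. by rewrite mxE sumr_ge0 // => i _; rewrite mxE -expr2 sqr_ge0. Qed.

Lemma norm_row_eq0 n (x : 'rV[R]_n) : (x *m x^T) 0 0 = 0 -> x = 0.
Proof.
rewrite mxE => /eqP; rewrite psumr_eq0 => [/allP h|i _]; last first.
  by rewrite mxE -expr2 sqr_ge0.
apply/rowP => i; have := h i (mem_index_enum i).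
by rewrite !mxE -expr2 sqrf_eq0 => /eqP.
Qed.

(** Conjugation by [H] moves a unit eigenvector [v] to the first basis vector, which lowers the
    dimension in [symmetric_spectral]. *)
Lemma reflection_exists n (v : 'rV[R]_n.+1) : (v *m v^T) 0 0 = 1 ->
  exists H : 'M[R]_n.+1, [/\ H^T = H, H *m H = 1%:M & row 0 H = v].
Proof.
move=> vv; have [vE|vN] := eqVneq v (delta_mx 0 0).
  exists 1%:M; rewrite trmx1 mulmx1; split=> //.
  by rewrite vE; apply/rowP => j; rewrite !mxE eqxx eq_sym.
(* Householder reflection along [v - e_0]. *)
pose u := v - delta_mx 0 0.
have uu : (u *m u^T) 0 0 = 2 - 2 * v 0 0.
  have -> : u *m u^T = v *m v^T - v *m (delta_mx 0 0)^T
     - delta_mx 0 0 *m v^T + delta_mx 0 0 *m (delta_mx 0 0 : 'rV_n.+1)^T.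
    by rewrite /u linearB /= mulmxBl !mulmxBr opprD opprK addrA.
  have -> : v *m v^T = 1%:M by rewrite [LHS]mx11_scalar vv.
  by rewrite !trmx_delta -!colE -!rowE !mxE !eqxx /= !mulr1n; ring.
have cN : (u *m u^T) 0 0 != 0.
  by apply: contra_neq vN => /norm_row_eq0/eqP; rewrite subr_eq0 => /eqP.
have uE j : u 0 j = v 0 j - (j == 0)%:R by rewrite !mxE eqxx.
clearbody u; set c := (u *m u^T) 0 0 in uu cN.
have uuM : u *m u^T = c%:M by rewrite [LHS]mx11_scalar.
exists (1%:M - (2 / c) *: (u^T *m u)); split.
- by rewrite linearB /= trmx1 linearZ /= trmx_mul trmxK.
- rewrite mulmxBl mul1mx mulmxBr mulmx1 -scalemxAl -scalemxAr.
  rewrite -(mulmxA _ u) (mulmxA u) uuM mul_scalar_mx -scalemxAr !scalerA.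
  rewrite mulfVK // -addrA -opprD -scalerBl.
  rewrite -scalerDl; have -> : 2 / c + (2 / c - 2 / c * 2) = 0 by ring.
  by rewrite scale0r subr0.
- apply/rowP => j; rewrite !mxE big_ord1 !mxE.
  rewrite !uE uu (eq_sym 0 j).
  have hN : 2 - 2 * v 0 0 != 0 by rewrite -uu.
  by rewrite eqxx /=; field.
Qed.

Lemma symmetric_spectral n (A : 'M[R]_n) : A^T = A ->
  exists (P : 'M[R]_n) (d : 'rV[R]_n),
    P *m P^T = 1%:M /\ A = P^T *m diag_mx d *m P.
Proof.
elim: n => [|n IH] in A * => As.
  by exists 0, 0; split; apply/matrixP; case.
have [a /eigenvalueP[v0 v0A v0N]] := symmetric_eigenvalue As.
have nv : 0 < (v0 *m v0^T) 0 0.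
  by rewrite lt0r norm_row_ge0 andbT; apply: contra_neq v0N => /norm_row_eq0.
pose s := Num.sqrt ((v0 *m v0^T) 0 0).
have sN : s != 0 by rewrite gt_eqF // sqrtr_gt0.
pose v := s^-1 *: v0.
have vA : v *m A = a *: v by rewrite -scalemxAl v0A !scalerA mulrC.
have vv : (v *m v^T) 0 0 = 1.
  rewrite /v linearZ /= -scalemxAl -scalemxAr scalerA mxE.
  by rewrite -(sqr_sqrtr (ltW nv)) -/s; field.
have [H [Hs HH Hv]] := reflection_exists vv.
(* The first row of [B] is [a] times the first basis vector, so by symmetry [B] is block diagonal
   and induction applies to its lower block. *)
pose B : 'M_(1 + n) := H *m A *m H.
have Bs : B^T = B by rewrite /B !trmx_mul Hs As mulmxA.
have B0 : row 0 B = a *: delta_mx 0 0.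
  rewrite /B !row_mul Hv vA -scalemxAl -Hv -row_mul HH.
  by congr (_ *: _); apply/rowP => j; rewrite !mxE eqxx eq_sym.
have B0j j : B 0 j = a * (j == 0)%:R by have /rowP/(_ j) := B0; rewrite !mxE eqxx.
have AE : A = H *m B *m H.
  by rewrite /B -!mulmxA HH mulmx1 mulmxA HH mul1mx.
clearbody B; have Bds : (drsubmx B)^T = drsubmx B by rewrite -[in RHS]Bs trmx_drsub.
have [Q [e [QQ QE]]] := IH _ Bds.
have BE : B = block_mx a%:M 0 0 (drsubmx B).
  rewrite -[LHS]submxK; congr block_mx.
  - apply/matrixP => i j; rewrite !ord1 !mxE lshift0 B0j eqxx mulr1n.
    by rewrite mulr1.
  - apply/matrixP => i j; rewrite !ord1 !mxE lshift0 B0j.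
    by rewrite -val_eqE /= mulr0.
  - apply/matrixP => i j; rewrite !ord1 !mxE lshift0 -Bs mxE B0j.
    by rewrite -val_eqE /= mulr0.
pose Q1 : 'M_(1 + n) := block_mx 1%:M 0 0 Q.
have Q1T : Q1^T = block_mx 1%:M 0 0 Q^T by rewrite tr_block_mx !trmx0 trmx1.
have Q1Q1 : Q1 *m Q1^T = 1%:M.
  rewrite Q1T mulmx_block !(mulmx0, mul0mx, addr0, add0r, mulmx1) QQ.
  by rewrite -scalar_mx_block.
have BQ : B = Q1^T *m diag_mx (row_mx a%:M e) *m Q1.
  rewrite [LHS]BE QE Q1T diag_mx_row !mulmx_block.
  rewrite !(mulmx0, mul0mx, addr0, add0r, mulmx1, mul1mx).
  by congr block_mx; apply/matrixP => i j; rewrite !ord1 !mxE eqxx !mulr1n.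
exists (Q1 *m H), (row_mx a%:M e : 'rV_(1 + n)); split.
  by rewrite trmx_mul Hs mulmxA -(mulmxA Q1) HH mulmx1.
by rewrite AE BQ trmx_mul Hs !mulmxA.
Qed.

End SpectralTheorem.

(** * Signature of symmetric forms and the reverse Cauchy-Schwarz inequality *)

Section LorentzianSignature.
Variables (R : realType) (n : nat).
Implicit Types (A P : 'M[R]_n) (x y w d : 'rV[R]_n).

Definition bform A x y : R := (x *m A *m y^T) 0 0.

Lemma bformE A x y : bform A x y = \sum_i (x *m A) 0 i * y 0 i.
Proof. by rewrite /bform mxE; apply: eq_bigr => i _; rewrite !mxE. Qed.

Lemma bformC A x y : A^T = A -> bform A x y = bform A y x.
Proof.
move=> As; rewrite /bform -[RHS]trace_mx11 -mxtrace_tr !trmx_mul trmxK As.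
by rewrite mulmxA trace_mx11.
Qed.

Lemma bformD A x1 x2 y : bform A (x1 + x2) y = bform A x1 y + bform A x2 y.
Proof. by rewrite /bform !mulmxDl mxE. Qed.

Lemma bformZ A a x y : bform A (a *: x) y = a * bform A x y.
Proof. by rewrite /bform -!scalemxAl mxE. Qed.

Lemma bform_mxD A B t x y :
  bform (A + t *: B) x y = bform A x y + t * bform B x y.
Proof. by rewrite /bform mulmxDr mulmxDl -scalemxAr -scalemxAl !mxE. Qed.

Lemma bform_delta A i j :
  bform A (delta_mx 0 i) (delta_mx 0 j) = A i j.
Proof. by rewrite /bform -rowE trmx_delta -colE !mxE. Qed.

Lemma bform_comb A a b x y : A^T = A ->
  bform A (a *: x + b *: y) (a *: x + b *: y) =
  a ^+ 2 * bform A x x + 2 * a * b * bform A x y + b ^+ 2 * bform A y y.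
Proof.
move=> As; rewrite bformD !bformZ !(bformC _ (_ + _) As) !bformD !bformZ.
by rewrite (bformC y x As); ring.
Qed.

Lemma bform_diag A P d x y : A = P^T *m diag_mx d *m P ->
  bform A x y = \sum_k d 0 k * (x *m P^T) 0 k * (y *m P^T) 0 k.
Proof.
move=> ->; rewrite /bform !mulmxA -(mulmxA _ P).
have -> : P *m y^T = (y *m P^T)^T by rewrite trmx_mul trmxK.
rewrite mul_mx_diag mxE; apply: eq_bigr => k _; by rewrite !mxE; ring.
Qed.

Lemma char_poly_diag A P d : P *m P^T = 1%:M -> A = P^T *m diag_mx d *m P ->
  char_poly A = \prod_(i < n) ('X - (d 0 i)%:P).
Proof.
move=> PP ->; have PTP : P^T *m P = 1%:M by apply: mulmx1C.
transitivity (char_poly (diag_mx d)); last first.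
  rewrite char_poly_trig ?diag_mx_is_trig //.
  by apply: eq_bigr => i _; rewrite mxE eqxx mulr1n.
(* The characteristic matrix lives over [R[X]], so the conjugating matrices are lifted to constant
   polynomials. *)
pose Q := map_mx (@polyC R) P; pose QT := map_mx (@polyC R) P^T.
have QQ : QT *m Q = 1%:M by rewrite -map_mxM PTP map_mx1.
rewrite /char_poly; have -> : char_poly_mx (P^T *m diag_mx d *m P) =
    QT *m char_poly_mx (diag_mx d) *m Q.
  rewrite /char_poly_mx !map_mxM mulmxBr mulmxBl; congr (_ - _).
  by rewrite mul_mx_scalar -scalemxAl QQ scalemx1.
by rewrite !det_mulmx mulrAC -det_mulmx QQ det1 mul1r.
Qed.

(** The multiplicity of [b] in the characteristic polynomial is the number of entries of [d] equal
    to [b]. *)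
Lemma one_pos_eigenvalue_diag A P d :
  P *m P^T = 1%:M -> A = P^T *m diag_mx d *m P ->
  one_pos_eigenvalue A <->
  exists k0, 0 < d 0 k0 /\ forall k, k != k0 -> d 0 k <= 0.
Proof.
move=> PP AE; have charE := char_poly_diag PP AE.
have charE' : char_poly A = \prod_(c <- [seq d 0 i | i <- enum 'I_n]) ('X - c%:P).
  by rewrite charE big_map big_enum.
have eigE b : eigenvalue A b = [exists i, d 0 i == b].
  rewrite eigenvalue_root_char charE' root_prod_XsubC.
  apply/mapP/existsP => [[i _ ->]|[i /eqP <-]]; exists i => //.
  by rewrite mem_enum.
have mupE b : mup b (char_poly A) = #|[pred i | d 0 i == b]|.
  rewrite charE' mu_prod_XsubC count_map cardE -size_filter /enum_mem.
  rewrite -filter_predI /=; congr size; rewrite -enumT /= enumT.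
  by apply: eq_filter => i; rewrite !inE andbT.
split=> [[a [a0]]|[k0 [k00 kle]]].
  rewrite mupE => /eqP/card1P[k0 kP] aP; exists k0.
  have /eqP dk0 : d 0 k0 == a by have := kP k0; rewrite !inE eqxx => ->.
  rewrite dk0; split=> // k kk; rewrite leNgt; apply: contra kk => dk.
  have := kP k; rewrite !inE => <-; apply/eqP/aP => //.
  by rewrite eigE; apply/existsP; exists k.
exists (d 0 k0); split=> //.
  rewrite mupE; apply/eqP/card1P; exists k0 => k; rewrite !inE.
  apply/eqP/eqP => [dk|-> //]; apply/eqP; apply: contraTT k00 => /kle.
  by rewrite dk leNgt.
move=> b b0; rewrite eigE => /existsP[k /eqP dk].
by have [<-//|/kle] := eqVneq k k0; rewrite dk leNgt b0.
Qed.

Lemma one_pos_eigenvalue_le0 A w x : A^T = A -> one_pos_eigenvalue A ->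
  0 < bform A w w -> bform A x w = 0 -> bform A x x <= 0.
Proof.
move=> As; have [P [d [PP AE]]] := symmetric_spectral As.
move=> /(one_pos_eigenvalue_diag PP AE)[k0 [k00 kle]] ww xw.
have hyp y : (y *m P^T) 0 k0 = 0 -> bform A y y <= 0.
  move=> y0; rewrite (bform_diag _ _ AE) sumr_le0 // => k _.
  have [->|/kle dk] := eqVneq k k0; first by rewrite y0 !mulr0.
  by rewrite -mulrA -expr2 mulr_le0_ge0 // sqr_ge0.
rewrite leNgt; apply/negP => xx.
(* The form is nonpositive on [c x - e w], which is orthogonal to the positive
   eigenvector. *)
pose c := (w *m P^T) 0 k0; pose e := (x *m P^T) 0 k0.
have /hyp : ((c *: x + (- e) *: w) *m P^T) 0 k0 = 0.
  rewrite mulmxDl -!scalemxAl mxE [X in X + _]mxE [X in _ + X]mxE -/c -/e.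
  by ring.
rewrite bform_comb // xw mulr0 addr0 sqrrN => h.
(* If [c = 0], then [w] itself is orthogonal to the positive eigenvector, against
   [0 < bform A w w]. *)
have [c0|cN] := eqVneq c 0; first by have := hyp _ c0; rewrite leNgt ww.
have c2 : 0 < c ^+ 2 by rewrite exprn_even_gt0.
have := mulr_ge0 (sqr_ge0 e) (ltW ww); have := mulr_gt0 c2 xx; lra.
Qed.

(** The left side minus the right side is the value of the form at [x - c w], the part of [x] that
    is [A]-orthogonal to [w]. *)
Lemma reverse_CauchySchwarz A w x :
  A^T = A -> one_pos_eigenvalue A -> 0 < bform A w w ->
  bform A x x <= bform A x w ^+ 2 / bform A w w.
Proof.
move=> As Aone ww; have wN : bform A w w != 0 by rewrite gt_eqF.
pose c := bform A x w / bform A w w.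
have cw : bform A (1 *: x + (- c) *: w) w = 0.
  by rewrite bformD !bformZ /c; field.
have := one_pos_eigenvalue_le0 As Aone ww cw.
rewrite bform_comb // => yy; rewrite -subr_le0; apply: le_trans yy.
by rewrite le_eqVlt; apply/orP; left; apply/eqP; rewrite /c; field.
Qed.

(** Converse of [one_pos_eigenvalue_le0]: [w] forces one positive entry of [d], and nonpositivity on
    its [A]-orthogonal excludes a second. *)
Lemma le0_one_pos_eigenvalue A w : A^T = A -> 0 < bform A w w ->
  (forall x, bform A x w = 0 -> bform A x x <= 0) -> one_pos_eigenvalue A.
Proof.
move=> As; have [P [d [PP AE]]] := symmetric_spectral As => ww xle.
apply/(one_pos_eigenvalue_diag PP AE).
have rowP k l : (row k P *m P^T) 0 l = (k == l)%:R.
  by rewrite -row_mul PP !mxE.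
have bP k l : bform A (row k P) (row l P) = d 0 k * (k == l)%:R.
  rewrite (bform_diag _ _ AE) (bigD1 k) //= big1 => [|i ik]; last first.
    by rewrite rowP eq_sym (negPf ik) mulr0 mul0r.
  by rewrite !rowP eqxx mulr1 addr0 eq_sym.
have [k0 dk0] : exists k0, 0 < d 0 k0.
  apply/not_existsP => h; move: ww; rewrite (bform_diag _ _ AE) ltNge.
  rewrite sumr_le0 // => k _; rewrite -mulrA -expr2 mulr_le0_ge0 ?sqr_ge0 //.
  by rewrite leNgt; apply/negP/h.
exists k0; split=> // k kk0; rewrite leNgt; apply/negP => dk.
(* The plane of two positive eigenvectors would meet the [A]-orthogonal of [w]. *)
pose c := bform A (row k P) w; pose e := bform A (row k0 P) w.
have := xle (c *: row k0 P + (- e) *: row k P).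
rewrite bform_comb // bformD !bformZ !bP !eqxx [k0 == k]eq_sym (negPf kk0).
rewrite !mulr0 !mulr1 addr0 sqrrN -/c -/e.
rewrite mulrC mulNr subrr => /(_ erefl).
have [c0|cN] := eqVneq c 0.
  have := xle _ c0; rewrite bP eqxx mulr1 leNgt dk //.
have c2 : 0 < c ^+ 2 by rewrite exprn_even_gt0.
have := mulr_ge0 (sqr_ge0 e) (ltW dk); have := mulr_gt0 c2 dk0; lra.
Qed.

End LorentzianSignature.

(** * Perron-Frobenius through a Dirichlet form *)

Section PerronFrobenius.
Variables (R : realType) (n : nat) (A : 'M[R]_n) (w : 'rV[R]_n).
Hypothesis As : A^T = A.
Hypothesis A_ge0 : offdiag_nonneg A.
Hypothesis w_gt0 : forall i, 0 < w 0 i.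

Let AC i j : A i j = A j i. Proof. by rewrite -[in RHS]As mxE. Qed.

(** The right side is the Dirichlet form of the ratios [y_i / w_i]; it counts each pair of indices
    twice, whence the factor [2]. *)
Lemma perron_gap (y : 'rV[R]_n) :
  2 * (\sum_i (w *m A) 0 i / w 0 i * y 0 i ^+ 2 - bform A y y) =
  \sum_i \sum_j A i j * w 0 i * w 0 j * (y 0 i / w 0 i - y 0 j / w 0 j) ^+ 2.
Proof.
have wN i : w 0 i != 0 by rewrite gt_eqF.
pose F i j := A i j * w 0 j / w 0 i * y 0 i ^+ 2.
pose G i j := A i j * y 0 i * y 0 j.
(* The weighted norm is written once with [F i j] and once with [F j i], so that each term becomes a
   complete square. *)
transitivity (\sum_i \sum_j F i j + \sum_i \sum_j F j i - 2 * \sum_i \sum_j G i j).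
  rewrite [X in _ = _ + X - _]exchange_big /=.
  have -> : bform A y y = \sum_i \sum_j G i j.
    rewrite bformE exchange_big /=; apply: eq_bigr => i _.
    rewrite mxE mulr_suml; apply: eq_bigr => j _.
    by rewrite /G; ring.
  have -> : \sum_i (w *m A) 0 i / w 0 i * y 0 i ^+ 2 = \sum_i \sum_j F i j.
    apply: eq_bigr => i _; rewrite mxE !mulr_suml; apply: eq_bigr => j _.
    by rewrite /F AC; ring.
  by ring.
rewrite mulr_sumr -sumrN -!big_split; apply: eq_bigr => i _ /=.
rewrite mulr_sumr -sumrN -!big_split; apply: eq_bigr => j _ /=.
by rewrite /F /G (AC j i); have := wN i; have := wN j => ? ?; field; apply/andP.
Qed.

(** The sign of [A i i] is unknown, but the square vanishes when [i = j]. *)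
Let term_ge0 (y : 'rV[R]_n) i j :
  0 <= A i j * w 0 i * w 0 j * (y 0 i / w 0 i - y 0 j / w 0 j) ^+ 2.
Proof.
have [->|ij] := eqVneq i j; first by rewrite subrr expr0n mulr0.
rewrite mulr_ge0 ?sqr_ge0 // !mulr_ge0 //; [exact: A_ge0 | exact: ltW |].
exact: ltW.
Qed.

Lemma perron_le (y : 'rV[R]_n) :
  bform A y y <= \sum_i (w *m A) 0 i / w 0 i * y 0 i ^+ 2.
Proof.
rewrite -subr_ge0 -(pmulr_rge0 _ (ltr0n _ 2)) perron_gap.
by apply: sumr_ge0 => i _; apply: sumr_ge0 => j _.
Qed.

(** Equality makes every term of [perron_gap] zero, so [y_i / w_i] agrees across nonzero entries of
    [A]; irreducibility links any two indices by such entries. *)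
Lemma perron_simple (y : 'rV[R]_n) : irreducible_mx A ->
  bform A y y = \sum_i (w *m A) 0 i / w 0 i * y 0 i ^+ 2 ->
  exists c, y = c *: w.
Proof.
move=> Airr yE; have := perron_gap y; rewrite -yE subrr mulr0 => /esym/eqP.
rewrite psumr_eq0 => [/allP h|i _]; last exact: sumr_ge0.
have adj i j : A i j != 0 -> y 0 i / w 0 i = y 0 j / w 0 j.
  move=> Aij; have := h i (mem_index_enum i); rewrite /= psumr_eq0 //.
  move=> /allP/(_ j (mem_index_enum j)); rewrite /= 3!mulf_eq0 expf_eq0 /=.
  by rewrite (negPf Aij) !(gt_eqF (w_gt0 _)) /= subr_eq0 => /eqP.
have conn (s : seq 'I_n) i :
    \prod_(c <- pairmap (fun a b => A a b) i s) c != 0 ->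
    y 0 i / w 0 i = y 0 (last i s) / w 0 (last i s).
  elim: s i => //= j s IH i; rewrite big_cons mulf_eq0 negb_or => /andP[Aij].
  by move=> /IH <-; exact: adj.
have cst i j : y 0 i / w 0 i = y 0 j / w 0 j.
  have [->//|/Airr[s [_ <- sP]]] := eqVneq i j.
  by apply: conn; rewrite gt_eqF.
case: (pickP 'I_n) => [i _|n0]; last first.
  by exists 0; apply/rowP => i; have := n0 i.
exists (y 0 i / w 0 i); apply/rowP => j.
by rewrite mxE (cst i j) divfK // gt_eqF.
Qed.

End PerronFrobenius.

(** Instead of [B = D^-1 A], its symmetric conjugate [S = D^(-1/2) A D^(-1/2)] is diagonalized. *)
Lemma bochner_perron (R : realType) n (A : 'M[R]_n) (w : 'rV[R]_n) :
  A^T = A -> offdiag_nonneg A -> irreducible_mx A ->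
  (forall i, 0 < w 0 i) -> (forall i, 0 < (w *m A) 0 i) ->
  (forall x : 'rV[R]_n, bform A x x <=
     \sum_i w 0 i * (x *m A) 0 i ^+ 2 / (w *m A) 0 i) ->
  forall x, bform A x w = 0 -> bform A x x <= 0.
Proof.
move=> As A_ge0 Airr w0 wA0 bochner x xw.
(* [s] and [t] hold the diagonals of [D^(1/2)] and [D^(-1/2)]. *)
pose s : 'rV[R]_n := \row_i Num.sqrt ((w *m A) 0 i / w 0 i).
have s0 i : 0 < s 0 i by rewrite mxE sqrtr_gt0 divr_gt0.
have sE i : s 0 i ^+ 2 = (w *m A) 0 i / w 0 i.
  by rewrite mxE sqr_sqrtr // ltW // divr_gt0.
pose t : 'rV[R]_n := \row_i (s 0 i)^-1.
have ts i : t 0 i * s 0 i = 1 by rewrite mxE mulVf // gt_eqF.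
clearbody t s.
pose S := diag_mx t *m A *m diag_mx t.
have Ss : S^T = S by rewrite /S !trmx_mul !tr_diag_mx As mulmxA.
have bS u v : bform S u v = bform A (u *m diag_mx t) (v *m diag_mx t).
  by rewrite /bform /S trmx_mul tr_diag_mx !mulmxA.
have [P [d [PP SE]]] := symmetric_spectral Ss.
(* A positive eigenvalue of [S] must be [1]; its eigenvector, rescaled by [t], then attains equality
   in [perron_le]. *)
have key k : 0 < d 0 k -> exists c, row k P *m diag_mx t = c *: w.
  move=> dk; set p := row k P; set y := p *m diag_mx t.
  have pS : p *m S = d 0 k *: p.
    rewrite /p -row_mul SE !mulmxA PP mul1mx row_mul row_diag_mx.
    by rewrite -scalemxAl -rowE.
  have pp : \sum_i p 0 i ^+ 2 = 1.
    transitivity ((P *m P^T) k k); last by rewrite PP mxE eqxx.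
    by rewrite mxE; apply: eq_bigr => i _; rewrite !mxE expr2.
  clearbody p; have yE i : y 0 i = p 0 i * t 0 i by rewrite /y mul_mx_diag mxE.
  have yA i : (y *m A) 0 i = d 0 k * p 0 i * s 0 i.
    have /rowP/(_ i) := pS; rewrite /S !mulmxA -/y mul_mx_diag [in RHS]mxE mxE.
    by move=> <-; rewrite -mulrA ts mulr1.
  have yAy : bform A y y = d 0 k.
    rewrite bformE -[RHS]mulr1 -pp mulr_sumr; apply: eq_bigr => i _.
    rewrite yA yE.
    transitivity (d 0 k * p 0 i ^+ 2 * (t 0 i * s 0 i)); first by ring.
    by rewrite ts mulr1.
  have ynorm : \sum_i (w *m A) 0 i / w 0 i * y 0 i ^+ 2 = 1.
    rewrite -pp; apply: eq_bigr => i _; rewrite -sE yE.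
    transitivity (p 0 i ^+ 2 * (t 0 i * s 0 i) ^+ 2); first by ring.
    by rewrite ts expr1n mulr1.
  have d_le1 : d 0 k <= 1 by rewrite -yAy -ynorm; exact: perron_le.
  (* At [y] the hypothesis [bochner] reads [d_k <= d_k ^+ 2]. *)
  have d_ge1 : 1 <= d 0 k.
    rewrite -(ler_pM2l dk) mulr1 -[leLHS]yAy (le_trans (bochner y)) //.
    rewrite -[leRHS]mulr1 -pp mulr_sumr le_eqVlt; apply/orP; left; apply/eqP.
    apply: eq_bigr => i _; rewrite yA exprMn sE; field.
    by rewrite !gt_eqF.
  apply: (perron_simple As A_ge0 w0 Airr); rewrite ynorm yAy.
  by apply/le_anti/andP.
pose x' := x *m diag_mx s.
have x't : x' *m diag_mx t = x.
  apply/rowP => i; rewrite mul_mx_diag mxE /x' mul_mx_diag [X in X * _]mxE.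
  by rewrite -mulrA [s 0 i * _]mulrC ts mulr1.
rewrite -x't -bS (bform_diag _ _ SE) sumr_le0 // => k _.
have [dk|/key[c yE]] := leP (d 0 k) 0.
  by rewrite -mulrA -expr2 mulr_le0_ge0 ?sqr_ge0.
(* The coordinate of [x'] along an eigenvector with positive eigenvalue is a multiple of
   [bform A w x], which is zero. *)
suff -> : (x' *m P^T) 0 k = 0 by rewrite !mulr0.
transitivity (c * bform A w x); last first.
  by rewrite bformC // xw mulr0.
rewrite mxE bformE mulr_sumr; apply: eq_bigr => i _.
have /rowP/(_ i) := yE; rewrite mul_mx_diag !mxE => pE.
have pk : P k i = c * w 0 i * s 0 i by rewrite -pE -mulrA ts mulr1.
have -> : \sum_j w 0 j * A j i = (w *m A) 0 i by rewrite mxE.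
have -> : \sum_j x 0 j * diag_mx s j i = x 0 i * s 0 i.
  by have /rowP/(_ i) := mul_mx_diag x s; rewrite 2!mxE.
rewrite pk; transitivity (c * (s 0 i ^+ 2 * w 0 i * x 0 i)); first by ring.
by rewrite sE divfK ?gt_eqF.
Qed.

(** * Directional derivatives, Hessians and homogeneity *)

Section DirectionalDerivatives.
Variables (R : realType) (n : nat).
Implicit Types (f g : {mpoly R[n]}) (u v w x y : 'rV[R]_n) (vs : seq 'rV[R]_n).

Lemma mderiv_dirD v i g : (dirD v g)^`M(i) = dirD v g^`M(i).
Proof.
rewrite /dirD raddf_sum /=; apply: eq_bigr => j _.
by rewrite mderivZ mderiv_comm.
Qed.

Lemma dirDC u v g : dirD u (dirD v g) = dirD v (dirD u g).
Proof.
rewrite {1 4}/dirD.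
transitivity (\sum_i \sum_j (u 0 i * v 0 j) *: g^`M(i)^`M(j)).
  apply: eq_bigr => i _; rewrite mderiv_dirD /dirD scaler_sumr.
  by apply: eq_bigr => j _; rewrite scalerA.
rewrite exchange_big; apply: eq_bigr => j _ /=.
rewrite mderiv_dirD /dirD scaler_sumr.
by apply: eq_bigr => i _; rewrite scalerA mulrC mderiv_comm.
Qed.

Lemma dirDDl u v g : dirD (u + v) g = dirD u g + dirD v g.
Proof.
by rewrite /dirD -big_split; apply: eq_bigr => i _; rewrite mxE scalerDl.
Qed.

Lemma dirDZl a v g : dirD (a *: v) g = a *: dirD v g.
Proof.
by rewrite /dirD scaler_sumr; apply: eq_bigr => i _; rewrite mxE scalerA.
Qed.

Lemma mderiv_dirDs vs i g : (dirDs vs g)^`M(i) = dirDs vs g^`M(i).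
Proof. by elim: vs => //= v vs IH; rewrite mderiv_dirD IH. Qed.

Lemma hessian_sym g : (hessian g)^T = hessian g.
Proof. by apply/matrixP => i j; rewrite !mxE mderiv_comm. Qed.

Lemma hessianD f g : hessian (f + g) = hessian f + hessian g.
Proof. by apply/matrixP => i j; rewrite !mxE !mderivD mcoeffD. Qed.

Lemma dirval_hessian x y vs g :
  dirval [:: x, y & vs] g = bform (hessian (dirDs vs g)) x y.
Proof.
rewrite bformE /dirval /= {1}/dirD raddf_sum /=.
transitivity (\sum_(i < n) \sum_(j < n) x 0 i * y 0 j * (hessian (dirDs vs g)) i j).
  apply: eq_bigr => i _; rewrite mcoeffZ mderiv_dirD /dirD raddf_sum mulr_sumr /=.
  by apply: eq_bigr => j _; rewrite mcoeffZ mulrA mxE.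
rewrite exchange_big; apply: eq_bigr => j _ /=.
rewrite mxE mulr_suml; apply: eq_bigr => i _; ring.
Qed.

(** Translates the signature condition of [lorentzian_deg] into one on a Hessian. *)
Lemma gram_dirval vs g :
  gram (fun x y => dirval [:: x, y & vs] g) = hessian (dirDs vs g).
Proof.
by apply/matrixP => i j; rewrite mxE dirval_hessian bform_delta.
Qed.

(** Symmetry of third partial derivatives: the identity [(x A)_i = x A_i w] of the overview. *)
Lemma row_hessian_dirD x w g i :
  (x *m hessian (dirD w g)) 0 i = bform (hessian g^`M(i)) x w.
Proof.
rewrite bformE mxE.
transitivity (\sum_(j < n) \sum_(l < n) x 0 j * w 0 l * (hessian g^`M(i)) j l).
  apply: eq_bigr => j _; rewrite mxE !mderiv_dirD /dirD raddf_sum mulr_sumr /=.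
  by apply: eq_bigr => l _; rewrite mcoeffZ mxE mulrA (mderiv_comm j i).
rewrite exchange_big; apply: eq_bigr => l _ /=.
rewrite mxE mulr_suml; apply: eq_bigr => j _; ring.
Qed.

(** With [w] as first direction, this yields [A = sum_i w_i A_i] at the level of values. *)
Lemma dirval_cons w vs g :
  dirval (w :: vs) g = \sum_i w 0 i * dirval vs g^`M(i).
Proof.
rewrite /dirval /= {1}/dirD raddf_sum /=; apply: eq_bigr => i _.
by rewrite mcoeffZ mderiv_dirDs.
Qed.

Lemma dirDs0 vs : dirDs vs 0 = 0 :> {mpoly R[n]}.
Proof.
by elim: vs => //= v vs ->; rewrite /dirD big1 // => i _; rewrite mderiv0 scaler0.
Qed.

Lemma mderiv_dhomog d f i :
  f \is d.-homog -> f^`M(i) \is d.-1.-homog.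
Proof.
move=> fh; rewrite (mpolyE f) raddf_sum /= big_seq; apply: rpred_sum => m mf.
(* A monomial without the variable [i] contributes zero, homogeneous of every degree; this includes
   [d = 0], where [d.-1] is [0]. *)
rewrite mderivZ mderivX; have [->|mi] := eqVneq (m i) 0%N.
  by rewrite scale0r scaler0 rpred0.
have Um : (U_(i) <= m)%MM by rewrite lep1mP.
apply/dhomogZ/dhomogZ; rewrite dhomogX /= -(dhomog_mf fh mf).
have mE : mdeg m = (mdeg (m - U_(i))).+1.
  by rewrite -[in LHS](submK Um) mdegD mdeg1 addn1.
by rewrite /= mE.
Qed.

End DirectionalDerivatives.

(** * Open convex cones and their lineality space *)

Section Cones.
Variables (R : realType) (n : nat) (K : set 'rV[R]_n).
Hypothesis Kopen : open K.
Hypothesis Kcone : is_cone K.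

Lemma open_coord x : K x ->
  exists2 e : R, 0 < e &
    forall z : 'rV[R]_n, (forall i, `|x 0 i - z 0 i| < e) -> K z.
Proof.
move: Kopen; rewrite openE => /(_ x) /[apply] /nbhs_ballP[e /= e0 eK].
exists e => // z xz; apply: eK; split=> // i j; rewrite ord1.
exact: xz.
Qed.

Lemma closure_coord y e : closure K y -> 0 < e ->
  exists2 z, K z & forall i, `|y 0 i - z 0 i| < e.
Proof.
move=> Ky e0; have [z [Kz [_ yz]]] := Ky _ (nbhsx_ballx y e e0).
by exists z => // i; exact: yz.
Qed.

Lemma open_shift x u : K x -> exists2 t : R, 0 < t & K (x + t *: u).
Proof.
(* [M] exceeds every [|u_i|], so a shift by [(e / M) u] moves each coordinate by less than [e]. *)
move=> /open_coord[e e0 eK]; pose M := 1 + \sum_i `|u 0 i|.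
have M0 : 0 < M by rewrite ltr_pwDl // sumr_ge0.
exists (e / M) => [|]; first exact: divr_gt0.
apply: eK => i; rewrite !mxE opprD addNKr normrN normrM gtr0_norm ?divr_gt0 //.
rewrite -mulrA gtr_pMr // mulrC ltr_pdivrMr // mul1r /M (bigD1 i) //=.
by rewrite addrCA ltrDl ltr_pwDl // sumr_ge0.
Qed.

(** For small [t > 0] both [x] and [x + t u] lie in the open set [K], so [t * l u = 0]. *)
Lemma linear_vanish (l : 'rV[R]_n -> R) x :
  (forall a u v, l (a *: u + v) = a * l u + l v) ->
  K x -> (forall v, K v -> l v = 0) -> forall u, l u = 0.
Proof.
move=> llin Kx l0 u; have [t t0 Kt] := open_shift u Kx.
have := l0 _ Kt; rewrite addrC llin (l0 _ Kx) addr0 => /eqP.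
by rewrite mulf_eq0 gt_eqF // => /eqP.
Qed.

Hypothesis Kconvex : convex_set K.

Lemma cone_add x y : K x -> K y -> K (x + y).
Proof.
move=> /mem_set Kx /mem_set Ky.
have h0 : 0 <= (2^-1 : R) by rewrite invr_ge0.
have h1 : (2^-1 : R) <= 1 by lra.
have /set_mem := Kconvex (Itv01 h0 h1) Kx Ky.
rewrite [X in K X](_ : _ = 2^-1 *: x + (1 - 2^-1) *: y) //.
have -> : (1 - 2^-1 : R) = 2^-1 by field.
rewrite -scalerDr => /(Kcone (ltr0Sn R 1)).
by rewrite scalerA divff ?scale1r // pnatr_eq0.
Qed.

(** Replace [y] by a nearby [z] in [K]; openness at [x] absorbs the error. *)
Lemma cone_add_closure x y : K x -> closure K y -> K (x + y).
Proof.
move=> /open_coord[e e0 eK] /closure_coord/(_ e0)[z Kz yz].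
rewrite -(subrK z y) addrA; apply: cone_add => //; apply: eK => i.
by rewrite !mxE opprD addNKr normrN.
Qed.

(** Both [y] and [- y] lie in the closure of [K], so either sign of [t] reduces to
    [cone_add_closure] after rescaling. *)
Lemma cone_add_lineality x y t : K x -> lineality K y -> K (x + t *: y).
Proof.
move=> Kx [Ky [z Kz zy]]; have zE : y = - z by rewrite -zy.
have pos s u : 0 < s -> closure K u -> K (x + s *: u).
  move=> s0 Ku; have sV : s^-1 != 0 by rewrite invr_neq0 // gt_eqF.
  have -> : x + s *: u = s *: (s^-1 *: x + u).
    by rewrite scalerDr scalerA divff ?scale1r // gt_eqF.
  apply: Kcone => //; apply: cone_add_closure => //.
  by apply: Kcone; rewrite ?invr_gt0.
have [t0|t0|->] := ltrgtP t 0.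
- have -> : t *: y = (- t) *: z by rewrite zE scalerN scaleNr.
  by apply: pos => //; rewrite oppr_gt0.
- exact: pos.
- by rewrite scale0r addr0.
Qed.
End Cones.

(** * Vanishing of derivatives along the lineality space *)

Section Lineality.
Variables (R : realType) (n d : nat) (f : {mpoly R[n]}) (K : set 'rV[R]_n).
Hypothesis fpos : forall vs : seq 'rV[R]_n, size vs = d ->
  (forall v, v \in vs -> K v) -> 0 < dirval vs f.

(** The line [v + t y] stays in [K], and there the derivative of [f] is affine in [t] and positive,
    so its slope is zero. Vanishing on [K] extends to all vectors by [linear_vanish]. *)
Lemma lineality_hessian0 vs v y : open K -> convex_set K -> is_cone K ->
  size vs = (d - 3)%N -> (3 <= d)%N ->
  (forall u, u \in vs -> K u) -> K v -> lineality K y ->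
  hessian (dirDs (y :: vs) f) = 0.
Proof.
move=> Kopen Kconvex Kcone szvs hd Kvs Kv Ly; set B := hessian _.
have Bs : B^T = B by exact: hessian_sym.
have BK a b : K a -> K b -> bform B a b = 0.
  move=> Ka Kb; apply: contrapT => /eqP eN.
  pose c := bform (hessian (dirDs (v :: vs) f)) a b; pose e := bform B a b.
  (* The root of the affine function [c + t e]. *)
  pose t := - c / e.
  have : 0 < dirval [:: a, b, v + t *: y & vs] f.
    apply: fpos => [|u]; first by rewrite /= szvs; lia.
    rewrite !inE => /or4P[/eqP->|/eqP->|/eqP->|/Kvs] //.
    exact: cone_add_lineality.
  rewrite dirval_hessian /= dirDDl dirDZl hessianD.
  have -> : hessian (t *: dirD y (dirDs vs f)) = t *: B.
    by apply/matrixP => i j; rewrite !mxE !mderivZ mcoeffZ.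
  by rewrite bform_mxD -/c -/e /t divfK // subrr ltxx.
have lin (b : 'rV[R]_n) (s : R) u w :
    bform B (s *: u + w) b = s * bform B u b + bform B w b.
  by rewrite bformD bformZ.
have BK1 a b : K b -> bform B a b = 0.
  by move=> Kb; apply: (linear_vanish Kopen (lin b) Kv) => u Ku; exact: BK.
apply/matrixP => i j; rewrite [RHS]mxE -bform_delta.
apply: (linear_vanish Kopen (lin (delta_mx 0 j)) Kv) => u Ku.
by rewrite bformC // BK1.
Qed.

End Lineality.

(** * Reduction of the theorem to the Hessian estimates *)

Unset Implicit Arguments.

Theorem theorem2p9 (R : realType) (n d : nat) (f : {mpoly R[n]})
    (K : set 'rV[R]_n)
    (hd : (3 <= d)%N) (hf : f \is d.-homog)
    (Kopen : open K) (Kconvex : convex_set K) (Kcone : is_cone K)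
    (Keff : effective K)
    (h1 : forall vs : d.-tuple 'rV[R]_n,
        (forall i, K (tnth vs i)) -> 0 < dirval vs f)
    (h2 : forall vs : (d - 2).-tuple 'rV[R]_n,
        (forall i, K (tnth vs i)) ->
        irreducible_mx (hessian (dirDs vs f)) /\
        offdiag_nonneg (hessian (dirDs vs f)))
    (h3 : forall i : 'I_n, lorentzian K f^`M(i)) :
  lorentzian K f.
Proof.
have fpos (vs : seq 'rV[R]_n) : size vs = d ->
    (forall v, v \in vs -> K v) -> 0 < dirval vs f.
  move=> /eqP sz Kvs; apply: (h1 (Tuple sz)) => i.
  by apply: Kvs; exact: mem_tnth.
right; exists d; first lia.
split=> // _ vs Kvs; rewrite gram_dirval.
have [Airr A_ge0] := h2 vs Kvs.
have {}Kvs v : v \in tval vs -> K v by move=> /tnthP[i ->].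
case: vs => /= vs /eqP szvs in Airr A_ge0 Kvs *.
(* Since [d - 2] is positive, there is a direction [v0] to be replaced by a positive [w]. *)
case: vs => [|v0 vs] /= in szvs Airr A_ge0 Kvs *; first by lia.
have szvs' : size vs = (d - 3)%N by lia.
have Kv0 : K v0 by apply: Kvs; rewrite mem_head.
have {}Kvs v : v \in vs -> K v by move=> vvs; apply: Kvs; rewrite inE vvs orbT.
move: (Kv0); rewrite Keff => -[w [Kw wpos] [y Ly v0E]].
set g := dirDs vs f in Airr A_ge0 *.
have v0w : hessian (dirD v0 g) = hessian (dirD w g).
  rewrite -v0E dirDDl hessianD.
  rewrite (lineality_hessian0 fpos Kopen Kconvex Kcone szvs' hd Kvs Kv0 Ly).
  exact: addr0.
rewrite v0w in Airr A_ge0 *; set A := hessian (dirD w g) in Airr A_ge0 *.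
have As : A^T = A by exact: hessian_sym.
have ww : 0 < bform A w w.
  rewrite /A -[dirD w g]/(dirDs (w :: vs) f) -dirval_hessian.
  apply: fpos => [|v]; first by rewrite /= szvs'; lia.
  by rewrite !inE => /or4P[/eqP->|/eqP->|/eqP->|/Kvs].
have gi i : g^`M(i) = dirDs vs f^`M(i) by exact: mderiv_dirDs.
(* A zero partial derivative would satisfy [lorentzian] as a constant, without any signature
   condition. It would make column [i] of [A] zero. *)
have fi_neq0 i : f^`M(i) != 0.
  apply/eqP => fi0; have gi0 : hessian g^`M(i) = 0.
    rewrite gi fi0 dirDs0; apply/matrixP => j k.
    by rewrite !mxE !mderiv0 mcoeff0.
  have Ai j : A j i = 0.
    have := row_hessian_dirD (delta_mx 0 j) w g i.
    by rewrite gi0 -/A -rowE mxE => ->; rewrite /bform mulmx0 mul0mx mxE.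
  (* A path leaving [i] would start with a zero entry of [A], so [i] is the only index; then
     [A = 0], against [ww]. *)
  have all_i j : j = i.
    have [//|jNi] := eqVneq i j; have := Airr _ _ jNi; case=> [[|a s]] [] /=.
      by move=> _ ij; rewrite ij eqxx in jNi.
    by move=> _ _; rewrite big_cons -As mxE Ai mul0r ltxx.
  move: ww; rewrite bformE big1 ?ltxx // => j _.
  by rewrite (all_i j) row_hessian_dirD gi0 /bform mulmx0 mul0mx mxE mul0r.
have fi_lor i : lorentzian_deg K d.-1 f^`M(i).
  have fih := mderiv_dhomog i hf.
  (* A nonzero constant has degree [0], whereas [d.-1] is at least [2]. *)
  case: (h3 i) => [[c _ cE]|[m m1 [fim fi_pos fi_one]]].
    have : c%:MP \is [in R[n], 0.-homog].
      by rewrite -[c%:MP]mulr1 mul_mpolyC dhomogZ ?dhomog1.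
    rewrite -cE => /(dhomog_uniq (fi_neq0 i) fih); lia.
  by have -> : d.-1 = m by exact: dhomog_uniq fih fim.
have sz1 : size vs == (d.-1 - 2)%N by apply/eqP; lia.
have fi_one i : one_pos_eigenvalue (hessian g^`M(i)).
  have [_ _ /(_ _ (Tuple sz1))] := fi_lor i.
  rewrite gram_dirval /= -gi; apply; first lia.
  by move=> j; apply: Kvs; exact: mem_tnth.
have wwi i : 0 < bform (hessian g^`M(i)) w w.
  have sz2 : size [:: w, w & vs] == d.-1 by apply/eqP => /=; lia.
  have [_ /(_ (Tuple sz2)) + _] := fi_lor i.
  rewrite gi -dirval_hessian; apply => j.
  have := mem_tnth j (Tuple sz2); rewrite !inE.
  by case/or3P => [/eqP->|/eqP->|/Kvs].
apply: (le0_one_pos_eigenvalue As ww).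
apply: (bochner_perron As A_ge0 Airr wpos) => [i|x].
  by rewrite row_hessian_dirD.
have -> : bform A x x = \sum_i w 0 i * bform (hessian g^`M(i)) x x.
  rewrite -[A]/(hessian (dirDs (w :: vs) f)) -dirval_hessian /dirval /=.
  (* Moving [w] to the front lets [dirval_cons] expand along it. *)
  rewrite (dirDC x w) (dirDC x w) -[LHS]/(dirval [:: w, x, x & vs] f) dirval_cons.
  by apply: eq_bigr => i _; rewrite dirval_hessian gi.
(* Each summand is the reverse Cauchy-Schwarz inequality for [A_i], weighted by [w_i > 0]. *)
apply: ler_sum => i _; rewrite !row_hessian_dirD -mulrA ler_pM2l; last exact: wpos.
by apply: reverse_CauchySchwarz => //; exact: hessian_sym.
Qed.
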